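(* Let $L>0$, $\mu\in(-\infty,0]$, $\kappa:=\mu/L$, let $f:\mathbb{R}^d\to\mathbb{R}$ belong to $\mathcal{F}_{\mu,L}$ with $f_*:=\inf_x f(x)>-\infty$, and let $N\ge1$ be an integer. Put $$\overline{\gamma L}_1(\kappa):=\frac{3}{1+\kappa+\sqrt{1-\kappa+\kappa^2}}\in\big[\tfrac32,2\big).$$ Let $x_{i+1}=x_i-\gamma_i\nabla f(x_i)$, $i=0,\dots,N-1$, be $N$ iterations of gradient descent started from $x_0\in\mathbb{R}^d$ with stepsizes satisfying $\gamma_iL\in(0,\overline{\gamma L}_1(\kappa)]$ for $i=0,\dots,N-1$. Then $$\frac{1}{2L}\min_{0\le i\le N}\big\{\|\nabla f(x_i)\|^2\big\}\le\frac{f(x_0)-f_*}{1+\sum_{i=0}^{N-1}\gamma_iL\,p(\gamma_iL,\gamma_i\mu)},$$ where $$p(l,u):=2-\frac{-lu}{1-u-|1-l|}=\begin{cases}2-\dfrac{-lu}{l-u}, & l\in(0,1],\\[2mm] \dfrac{(2-l)(2-u)}{2-l-u}, & l\in[1,2).\end{cases}$$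
   Context: For $L\in(0,\infty)$ and $\mu\in(-\infty,L)$, $\mathcal{F}_{\mu,L}$ is the class of functions $f:\mathbb{R}^d\to\mathbb{R}$ such that both $\frac{L}{2}\|\cdot\|^2-f$ and $f-\frac{\mu}{2}\|\cdot\|^2$ are convex, where $\|\cdot\|$ is the Euclidean norm (such functions are differentiable). *)

(* Defs.v *)
From mathcomp Require Import all_boot all_order all_algebra.
From mathcomp Require Import all_classical all_reals all_analysis.
Import Order.TTheory GRing.Theory Num.Theory.
Import numFieldNormedType.Exports.
Set Implicit Arguments.
Unset Strict Implicit.
Unset Printing Implicit Defensive.
Local Open Scope classical_set_scope.
Local Open Scope ring_scope.

(* The canonical norm `|x| on 'rV[R]_d is the sup norm, hence this definition.
   Differentiability does not depend on the choice of the norm. *)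
Definition enorm (R : realType) (d : nat) (x : 'rV[R]_d) : R :=
  Num.sqrt (\sum_(i < d) x ord0 i ^+ 2).

(* The partial derivatives are total: they have a meaningful value only where
   the corresponding limits exist; see [gradP]. *)
Definition grad (R : realType) (d : nat) (f : 'rV[R]_d -> R) (x : 'rV[R]_d) :
    'rV[R]_d :=
  \row_(i < d) 'D_(delta_mx ord0 i) f x.

Lemma gradP (R : realType) (d : nat) (f : 'rV[R]_d -> R) (x v : 'rV[R]_d) :
  differentiable f x -> 'd f x v = \sum_(i < d) grad f x ord0 i * v ord0 i.
Proof.
move=> df; rewrite [in LHS](row_sum_delta v) linear_sum; apply: eq_bigr => i _.
by rewrite linearZ /= mxE deriveE // mulrC.
Qed.

Definition curvature_class (R : realType) (d : nat) (mu L : R)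
    (f : 'rV[R]_d -> R) : Prop :=
  convex_function [set: convex_lmodType 'rV[R]_d]
    (fun x => L / 2 * enorm x ^+ 2 - f x) /\
  convex_function [set: convex_lmodType 'rV[R]_d]
    (fun x => f x - mu / 2 * enorm x ^+ 2).

Definition gammaL1 (R : realType) (kappa : R) : R :=
  3 / (1 + kappa + Num.sqrt (1 - kappa + kappa ^+ 2)).

Definition pfun (R : realType) (l u : R) : R :=
  2 - (- l * u) / (1 - u - `|1 - l|).

(* Main.v *)
Require Import Defs.
From mathcomp Require Import all_boot all_order all_algebra.
From mathcomp Require Import all_classical all_reals all_analysis.
From mathcomp Require Import ring lra.
Import Order.TTheory GRing.Theory Num.Theory.
Import numFieldNormedType.Exports.
Local Open Scope classical_set_scope.
Local Open Scope ring_scope.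

(** Why the bound holds.

    Convexity of [L/2 |.|^2 - f] and of [f - mu/2 |.|^2] pinches [f], along
    every line through [x], between two parabolas with a common tangent at
    [x].  The slope of that tangent is the directional derivative; it turns out
    to be linear in the direction, so it is given by [grad f x]
    ([curvature_bounds]).

    Comparing the upper parabola at [x] with the lower one at [y], at the point
    where their difference is extremal, gives the interpolation inequality
    between [x] and [y] ([interpolation]).  Write it in both directions for a
    gradient step [y = x - gamma grad f x], with [l = gamma L] and
    [u = gamma mu].  A suitable nonnegative combination of the two
    ([weighted_decrease]) reads
      [A |grad f x|^2 + B |grad f y|^2 <= 2 L (f x - f y)]
    with [A, B >= 0] and [A + B = l p(l, u)].  For [l >= 1] the weights are
    chosen to cancel the inner product of the two gradients, and [A >= 0] is
    then exactly the condition [l <= gammaL1 (mu / L)] ([gammaL1_quadratic]).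
    For [l <= 1] one direction suffices, its inner product being absorbed by
    [2 <p, q> <= |p|^2 + |q|^2].

    Replacing both squared norms by the minimum over all iterates and
    telescoping gives the sum in the denominator; the additional [1] is
    [|grad f (x N)|^2 <= 2 L (f (x N) - inf f)], the decrease along one more
    step, of length [1 / L] ([sqr_grad_le]). *)

(** * The Euclidean inner product *)

Definition dot {R : realType} {d : nat} (u v : 'rV[R]_d) : R :=
  \sum_(i < d) u ord0 i * v ord0 i.

Section DotProduct.
Context {R : realType} {d : nat}.
Implicit Types u v w : 'rV[R]_d.

Lemma dotC u v : dot u v = dot v u.
Proof. by apply: eq_bigr => i _; rewrite mulrC. Qed.

Lemma dotDl u v w : dot (u + v) w = dot u w + dot v w.
Proof. by rewrite -big_split; apply: eq_bigr => i _; rewrite mxE mulrDl. Qed.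

Lemma dotZl a u v : dot (a *: u) v = a * dot u v.
Proof. by rewrite mulr_sumr; apply: eq_bigr => i _; rewrite mxE mulrA. Qed.

Lemma dotDr u v w : dot u (v + w) = dot u v + dot u w.
Proof. by rewrite dotC dotDl !(dotC u). Qed.

Lemma dotZr a u v : dot u (a *: v) = a * dot u v.
Proof. by rewrite dotC dotZl dotC. Qed.

Lemma dotNl u v : dot (- u) v = - dot u v.
Proof. by rewrite -scaleN1r dotZl mulN1r. Qed.

Lemma dotNr u v : dot u (- v) = - dot u v.
Proof. by rewrite dotC dotNl dotC. Qed.

Definition dotE := (dotDl, dotDr, dotNl, dotNr, dotZl, dotZr).

Lemma dot_ge0 u : 0 <= dot u u.
Proof. by apply: sumr_ge0 => i _; rewrite -expr2 sqr_ge0. Qed.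

Lemma sqr_enorm u : enorm u ^+ 2 = dot u u.
Proof.
by rewrite /enorm sqr_sqrtr ?sumr_ge0// => i _; rewrite sqr_ge0.
Qed.

Lemma dot_AGM u v : 2 * dot u v <= dot u u + dot v v.
Proof. by have := dot_ge0 (u - v); rewrite !dotE (dotC v u); lra. Qed.

End DotProduct.

(** * Slopes of functions of one real variable *)

Section LineLemmas.
Context {R : realType}.

(** A linear function below a parabola with apex at the origin vanishes: this
    is how two slopes that satisfy the same quadratic estimates are
    identified. *)
Lemma slope_eq0 (a K : R) : (forall t, t * a <= K * t ^+ 2) -> a = 0.
Proof.
move=> H; have k0 : 0 < `|K| + 1 by rewrite ltr_wpDl.
have := H (a / (`|K| + 1)).
set b := a / _; have -> : a = b * (`|K| + 1) by rewrite divfK ?gt_eqF.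
have := ler_norm K => Kk h; suff /eqP: b ^+ 2 == 0.
  by move=> /eqP; rewrite sqrf_eq0 => /eqP ->; rewrite mul0r.
by rewrite eq_le sqr_ge0 andbT; have := sqr_ge0 b; nra.
Qed.

(** The hypothesis is [2 m]-strong convexity at the origin with denominators
    cleared: each backward difference quotient, corrected by the parabola
    [m t^2], is below each forward one, so that the supremum of the former
    separates the two families. *)
Lemma supporting_slope (phi : R -> R) (m : R) :
  (forall s t, 0 < s -> 0 < t ->
    (s + t) * phi 0 <= t * phi (- s) + s * phi t - m * s * t * (s + t)) ->
  exists D, forall t, m * t ^+ 2 <= phi t - phi 0 - t * D.
Proof.
move=> H; pose q s := (phi 0 - phi (- s)) / s + m * s.
pose E := [set q s | s in [set s | 0 < s]].
have ubE t : 0 < t -> ubound E ((phi t - phi 0) / t - m * t).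
  move=> t0 _ [s /= s0 <-]; rewrite /q.
  have := H _ _ s0 t0 => h; rewrite -subr_ge0.
  have -> : (phi t - phi 0) / t - m * t - ((phi 0 - phi (- s)) / s + m * s)
    = (t * phi (- s) + s * phi t - m * s * t * (s + t) - (s + t) * phi 0)
      / (s * t) by field; rewrite !gt_eqF.
  by apply: divr_ge0; [rewrite subr_ge0|apply: mulr_ge0; exact: ltW].
exists (sup E) => t; have [t0|t0|->] := ltgtP t 0; last 1 first.
- by rewrite expr0n mulr0 mul0r subr0 subrr.
- have : q (- t) <= sup E.
    apply: ub_le_sup; last by exists (- t) => //=; rewrite oppr_gt0.
    by exists ((phi 1 - phi 0) / 1 - m * 1); apply: ubE.
  rewrite /q opprK invrN mulrN -(ler_nM2l t0) mulrDr mulrN.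
  have -> : t * ((phi 0 - phi t) / t) = phi 0 - phi t by field; rewrite lt_eqF.
  lra.
- have : sup E <= (phi t - phi 0) / t - m * t.
    by apply: ge_sup (ubE _ t0); exists (q 1), 1 => //=.
  rewrite -(ler_pM2l t0) mulrBr [t * (_ / t)]mulrCA divff ?gt_eqF// mulr1.
  lra.
Qed.

End LineLemmas.

(** * First-order bounds on the curvature class *)

Section Gradient.
Context {R : realType} {d : nat}.
Variables (mu L : R) (f : 'rV[R]_d -> R).
Hypothesis f_class : curvature_class mu L f.
Implicit Types x v w : 'rV[R]_d.

(** The squared norm has defect [t (1 - t) |x - v|^2] on a segment, which turns
    both convexity assumptions into bounds on the defect of [f]. *)
Lemma curvature_segment (t : R) x v : 0 <= t <= 1 ->
  let defect := t * f x + (1 - t) * f v - f (t *: x + (1 - t) *: v) in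
  mu / 2 * (t * (1 - t)) * dot (x - v) (x - v) <= defect
    <= L / 2 * (t * (1 - t)) * dot (x - v) (x - v).
Proof.
move=> /andP[t0 t1] /=; case: f_class => hL hmu.
have [mx my] : x \in [set: convex_lmodType 'rV[R]_d]
    /\ v \in [set: convex_lmodType 'rV[R]_d] by rewrite !inE.
have := hL (Itv01 t0 t1) _ _ mx my; have := hmu (Itv01 t0 t1) _ _ mx my.
rewrite !convRE /conv /= /unstable.onem !sqr_enorm !dotE (dotC v x) => h1 h2.
by apply/andP; split; lra.
Qed.

(** The number [D] is the slope at [x] in the direction [v], with the two
    quadratic error bounds that the curvature class provides. *)
Definition line_expansion x v (D : R) := forall t : R,
  mu / 2 * dot v v * t ^+ 2 <= f (x + t *: v) - f x - t * D
    <= L / 2 * dot v v * t ^+ 2.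

(** Applied to [f] and to [- f] along the line, [supporting_slope] yields two
    slopes; they are opposite because [slope_eq0] applies to their sum. *)
Lemma ex_line_expansion x v : exists D, line_expansion x v D.
Proof.
have seg s t : 0 < s -> 0 < t ->
    mu / 2 * dot v v * s * t * (s + t) <=
    t * f (x + - s *: v) + s * f (x + t *: v) - (s + t) * f x
    <= L / 2 * dot v v * s * t * (s + t).
  move=> s0 t0; have st0 : 0 < s + t by rewrite addr_gt0.
  have : 0 <= t / (s + t) <= 1.
    by rewrite ltW ?divr_gt0//= ler_pdivrMr// mul1r lerDr ltW.
  move=> /(curvature_segment _ (x + - s *: v) (x + t *: v)) /=.
  have -> : t / (s + t) *: (x + - s *: v) +
      (1 - t / (s + t)) *: (x + t *: v) = x.
    apply/rowP => i; rewrite !mxE; field; exact: lt0r_neq0.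
  have -> : (x + - s *: v) - (x + t *: v) = - (s + t) *: v.
    by apply/rowP => i; rewrite !mxE; ring.
  have -> : 1 - t / (s + t) = s / (s + t) by field; exact: lt0r_neq0.
  rewrite !dotE -(ler_pM2l st0) => /andP[h1].
  rewrite -(ler_pM2l st0) => h2.
  have e c : (s + t) * (c * (t / (s + t) * (s / (s + t))) *
      (- (s + t) * (- (s + t) * dot v v))) = c * dot v v * s * t * (s + t).
    by field; exact: lt0r_neq0.
  rewrite !e in h1 h2.
  have e2 : (s + t) * (t / (s + t) * f (x + - s *: v) +
      s / (s + t) * f (x + t *: v) - f x) =
      t * f (x + - s *: v) + s * f (x + t *: v) - (s + t) * f x.
    by field; exact: lt0r_neq0.
  by rewrite !e2 in h1 h2; rewrite h1.
have [|D hD] :=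
    @supporting_slope R (fun t => f (x + t *: v)) (mu / 2 * dot v v).
  move=> s t s0 t0; have /andP[h _] := seg s t s0 t0.
  by rewrite scale0r addr0; lra.
have [|D' hD'] :=
    @supporting_slope R (fun t => - f (x + t *: v)) (- (L / 2 * dot v v)).
  move=> s t s0 t0; have /andP[_ h] := seg s t s0 t0.
  by rewrite scale0r addr0; lra.
rewrite scale0r addr0 in hD hD'.
have DD' : D + D' = 0.
  apply: (@slope_eq0 R _ ((L - mu) / 2 * dot v v)) => t.
  by have := hD t; have := hD' t; lra.
exists D => t; rewrite hD /=; have := hD' t.
have -> : D' = - D by lra.
lra.
Qed.

Lemma expansion_derive x v (D : R) : line_expansion x v D -> 'D_v f x = D.
Proof.
move=> hD; apply/cvg_lim => //.
pose K := (`|L / 2| + `|mu / 2|) * dot v v.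
have K0 : 0 <= K by rewrite mulr_ge0 ?dot_ge0// addr_ge0.
have K1 : 0 < K + 1 by rewrite ltr_wpDl.
apply/cvgrPdist_le => e e0; near=> h.
have h0 : h != 0 by near: h; exact: nbhs_dnbhs_neq.
have he : `|h| * (K + 1) <= e.
  by rewrite -ler_pdivlMr//; near: h; apply: dnbhs0_le; rewrite divr_gt0.
apply: (@le_trans _ _ (K * `|h|)); last first.
  by apply: le_trans he; have := normr_ge0 h; lra.
have := hD h; rewrite /= -[h *: v + x]addrC.
set q := h^-1 *: _.
have -> : f (x + h *: v) - f x = h * q by rewrite /q mulrA divff// mul1r.
move=> /andP[h1 h2].
have hp : 0 < `|h| by rewrite normr_gt0.
rewrite distrC -(ler_pM2l hp).
have -> : `|h| * (K * `|h|) = K * h ^+ 2.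
  by rewrite -[h ^+ 2]real_normK ?num_real//; ring.
rewrite -normrM mulrBr ler_norml.
have P0 : 0 <= dot v v * h ^+ 2 by rewrite mulr_ge0 ?dot_ge0 ?sqr_ge0.
have bnd a : a * (dot v v * h ^+ 2) <= `|a| * (dot v v * h ^+ 2).
  by rewrite ler_wpM2r// ler_norm.
have := bnd (L / 2); have := bnd (- (mu / 2)); rewrite normrN.
have := mulr_ge0 (normr_ge0 (L / 2)) P0.
have := mulr_ge0 (normr_ge0 (mu / 2)) P0.
by rewrite /K => *; apply/andP; split; lra.
Unshelve. all: by end_near. Qed.

Lemma derive_expansion x v : line_expansion x v ('D_v f x).
Proof.
by have [D hD] := ex_line_expansion x v; rewrite (expansion_derive _ _ _ hD).
Qed.

Lemma deriveZ_curvature x (c : R) v : 'D_(c *: v) f x = c * 'D_v f x.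
Proof.
apply: expansion_derive => t; have := derive_expansion x v (t * c).
by rewrite scalerA !dotE; lra.
Qed.

(** The point [x + t (v + w)] is the midpoint of [x + 2 t v] and [x + 2 t w], so
    the midpoint inequality compares the three slopes up to [O(t^2)]. *)
Lemma deriveD_curvature x v w : 'D_(v + w) f x = 'D_v f x + 'D_w f x.
Proof.
apply/eqP; rewrite -subr_eq0; apply/eqP.
(* The constant collects the error terms of the three expansions and of the
   midpoint inequality. *)
apply: (@slope_eq0 R _ (L * (dot v v + dot w w)
  - mu / 2 * (dot (v + w) (v + w) + dot (v - w) (v - w)))) => t.
have half : 0 <= (2^-1 : R) <= 1 by lra.
have := curvature_segment _ (x + (2 * t) *: v) (x + (2 * t) *: w) half.
have -> : 2^-1 *: (x + (2 * t) *: v) + (1 - 2^-1) *: (x + (2 * t) *: w)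
  = x + t *: (v + w) by apply/rowP => i; rewrite !mxE; field.
have -> : x + (2 * t) *: v - (x + (2 * t) *: w) = (2 * t) *: (v - w).
  by apply/rowP => i; rewrite !mxE; ring.
have := derive_expansion x v (2 * t); have := derive_expansion x w (2 * t).
have := derive_expansion x (v + w) t.
by rewrite /= !dotE (dotC w v); lra.
Qed.

Lemma derive_grad x v : 'D_v f x = dot (grad f x) v.
Proof.
have D0 : 'D_0 f x = 0.
  by rewrite -[0 in LHS](scale0r 0) deriveZ_curvature mul0r.
rewrite [in LHS](row_sum_delta v).
rewrite (big_morph (fun w => 'D_w f x) (deriveD_curvature x) D0).
by apply: eq_bigr => i _; rewrite deriveZ_curvature mxE mulrC.
Qed.

Lemma curvature_bounds x v :
  mu / 2 * dot v v <= f (x + v) - f x - dot (grad f x) v <= L / 2 * dot v v.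
Proof.
have := derive_expansion x v 1.
by rewrite derive_grad scale1r mul1r expr1n !mulr1.
Qed.

(** The bounds at [x] and at [y] are compared at the point [x + w] that
    minimises the difference between the upper parabola at [x] and the lower
    one at [y]; stationarity there gives
    [w = - (grad f x - grad f y - mu (x - y)) / (L - mu)]. *)
Lemma interpolation x y : mu < L ->
  mu / 2 * dot (x - y) (x - y) +
    dot (grad f x - grad f y - mu *: (x - y))
        (grad f x - grad f y - mu *: (x - y)) / (2 * (L - mu))
  <= f x - f y - dot (grad f y) (x - y).
Proof.
move=> muL; have Lmu : 0 < L - mu by rewrite subr_gt0.
have [e eE] : {e | e = grad f x - grad f y - mu *: (x - y)} by eexists.
have [z zE] : {z | z = x - y} by eexists.
have [w wE] : {w | w = - (L - mu)^-1 *: e} by eexists.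
have /andP[_] := curvature_bounds x w.
have /andP[+ _] := curvature_bounds y (z + w).
have -> : y + (z + w) = x + w by rewrite addrA zE [y + _]addrC subrK.
rewrite -eE -zE.
have -> : grad f x = grad f y + mu *: z + e.
  by rewrite [RHS]addrC [grad f y + _]addrC eE -zE addrA !subrK.
have -> : dot e e / (2 * (L - mu)) = (L - mu) / 2 * dot w w.
  by rewrite wE !dotE; field; exact: lt0r_neq0.
have ew : dot e w = - (L - mu) * dot w w.
  by rewrite wE !dotE; field; exact: lt0r_neq0.
rewrite !dotE ew (dotC w z); lra.
Qed.

End Gradient.

(** * The stepsize threshold and the factor [pfun] *)

Section Stepsize.
Context {R : realType}.
Implicit Types kappa l u : R.

Lemma sqr_discr kappa : Num.sqrt (1 - kappa + kappa ^+ 2) ^+ 2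
  = 1 - kappa + kappa ^+ 2.
Proof. by rewrite sqr_sqrtr//; have := sqr_ge0 (kappa - 2^-1); lra. Qed.

Lemma gammaL1_denom kappa : kappa <= 0 ->
  3 / 2 < 1 + kappa + Num.sqrt (1 - kappa + kappa ^+ 2) <= 2.
Proof.
move=> k0; have := sqr_discr kappa; have := sqrtr_ge0 (1 - kappa + kappa ^+ 2).
by move: (Num.sqrt _) => s s0 sE; apply/andP; split; nra.
Qed.

Lemma gammaL1_bounds kappa : kappa <= 0 -> 3 / 2 <= gammaL1 kappa < 2.
Proof.
move=> /gammaL1_denom/andP[h1 h2]; rewrite /gammaL1.
by rewrite ler_pdivlMr ?ltr_pdivrMr; lra.
Qed.

(** Up to the factor 3, the quadratic in [l] factors as [(3 - l D) (3 - l D')]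
    with [D, D' = 1 + kappa +- sqrt (1 - kappa + kappa^2)], and the threshold is
    its positive root [3 / D], while [D' <= 0]. *)
Lemma gammaL1_quadratic kappa l : kappa <= 0 -> 0 < l <= gammaL1 kappa ->
  0 <= 3 - 2 * l - 2 * (kappa * l) + kappa * l * l.
Proof.
move=> k0 /andP[l0]; have /andP[D0 _] := gammaL1_denom _ k0.
have := sqr_discr kappa; rewrite /gammaL1; move: (Num.sqrt _) D0 => s D0 sE.
rewrite ler_pdivlMr; last lra.
move=> lD; pose D := 1 + kappa + s; pose D' := 1 + kappa - s.
have DD' : D * D' = 3 * kappa by rewrite /D /D'; lra.
have D'0 : D' <= 0 by rewrite -(@pmulr_rle0 _ D) ?DD' /D; lra.
have : 0 <= (3 - l * D) * (3 - l * D').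
  by rewrite mulr_ge0 ?subr_ge0//; have := mulr_ge0_le0 (ltW l0) D'0; lra.
have -> : (3 - l * D) * (3 - l * D')
    = 3 * (3 - 2 * l - 2 * (kappa * l)) + D * D' * l * l.
  by rewrite /D /D'; ring.
by rewrite DD'; lra.
Qed.

Lemma pfun_short l u : l <= 1 -> pfun l u = 2 - (- l * u) / (l - u).
Proof.
move=> l1; rewrite /pfun ger0_norm ?subr_ge0//.
by congr (_ - _ / _); ring.
Qed.

Lemma pfun_long l u : u <= 0 -> 1 <= l < 2 ->
  pfun l u = (2 - l) * (2 - u) / (2 - l - u).
Proof.
move=> u0 /andP[l1 l2]; rewrite /pfun ler0_norm ?subr_le0//.
have -> : 1 - u - - (1 - l) = 2 - l - u by ring.
by field; apply: lt0r_neq0; lra.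
Qed.

Lemma pfun_ge0 l u : u <= 0 -> 0 < l < 2 -> 0 <= pfun l u.
Proof.
move=> u0 /andP[l0 l2]; have [l1|/ltW l1] := leP l 1.
  rewrite pfun_short//.
  have -> : 2 - - l * u / (l - u) = (2 * l + (l - 2) * u) / (l - u).
    by field; apply: lt0r_neq0; lra.
  by apply: divr_ge0; nra.
rewrite pfun_long ?l1//; apply: divr_ge0; last lra.
by apply: mulr_ge0; lra.
Qed.

(** The scalar core of the one-step estimate: [a], [b], [c] stand for
    [|grad f x|^2], [|grad f y|^2] and their inner product, [T] for
    [2 L (f x - f y)], and [S] for [2 L] times the left side of the
    interpolation inequality, whose two directions bound it. *)
Lemma weighted_decrease l u a b c m S T :
  u <= 0 -> 0 < l < 2 -> 0 <= 3 - 2 * l - 2 * u + u * l ->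
  2 * c <= a + b -> m <= a -> m <= b ->
  (l - u) * S = l * ((1 - 2 * u + u * l) * a - 2 * (1 - u) * c + b) ->
  S <= T - 2 * l * c -> S <= 2 * l * a - T ->
  l * pfun l u * m <= T.
Proof.
move=> u0 /andP[l0 l2] q0 cab ma mb SE ST1 ST2.
have lu0 : 0 < l - u by lra.
have [l1|/ltW l1] := leP l 1.
  rewrite pfun_short// -(ler_pM2l lu0).
  have -> : (l - u) * (l * (2 - - l * u / (l - u)) * m)
      = l * ((l - 2 * u + u * l) * m + l * m).
    by field; exact: lt0r_neq0.
  (* [c] enters with the coefficient [- 2 (1 - l) <= 0], so an upper bound on
     [c] is what is needed. *)
  apply: (@le_trans _ _ ((l - u) * (S + 2 * l * c))); last first.
    by rewrite ler_pM2l//; lra.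
  have -> : (l - u) * (S + 2 * l * c)
      = l * ((1 - 2 * u + u * l) * a + b - (1 - l) * (2 * c)).
    by rewrite mulrDr SE; ring.
  rewrite ler_pM2l//.
  have h1 : (1 - l) * (2 * c) <= (1 - l) * (a + b).
    by rewrite ler_wpM2l// subr_ge0.
  have h2 : (l - 2 * u + u * l) * m <= (l - 2 * u + u * l) * a.
    by rewrite ler_wpM2l//; nra.
  have h3 : l * m <= l * b by rewrite ler_pM2l.
  lra.
have r0 : 0 < 2 - l - u by lra.
rewrite pfun_long ?l1// -(ler_pM2l r0).
have -> : (2 - l - u) * (l * ((2 - l) * (2 - u) / (2 - l - u)) * m)
    = l * ((3 - 2 * l - 2 * u + u * l) * m + m).
  by field; exact: lt0r_neq0.
(* Weighting the two bounds on [S] by [1 - u] and [l - 1] makes the terms in [c]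
   cancel and leaves the factor [2 - l - u] on [T]. *)
have h1 : (1 - u) * (S + 2 * l * c) <= (1 - u) * T by rewrite ler_wpM2l; lra.
have h2 : (l - 1) * (S - 2 * l * a) <= (l - 1) * (- T).
  by rewrite ler_wpM2l; lra.
have h3 : l * ((3 - 2 * l - 2 * u + u * l) * m + m)
    <= l * ((3 - 2 * l - 2 * u + u * l) * a + b).
  by rewrite ler_pM2l// lerD// ler_wpM2l.
lra.
Qed.

End Stepsize.

(** * Decrease along gradient steps *)

Section Descent.
Context {R : realType} {d : nat}.
Variables (mu L : R) (f : 'rV[R]_d -> R).
Hypotheses (L_gt0 : 0 < L) (mu_le0 : mu <= 0).
Hypothesis f_class : curvature_class mu L f.
Implicit Types x : 'rV[R]_d.

Lemma kappa_le0 : mu / L <= 0.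
Proof. by rewrite pmulr_lle0 ?invr_gt0. Qed.

(** Along the step, [x - y] is a multiple of [grad f x], so the interpolation
    inequality becomes a relation between the squared norms and the inner
    product of the two gradients only; multiplying by [2 L] leaves coefficients
    that depend on the stepsize through [gamma L] and [gamma mu] alone. *)
Lemma gradient_step_decrease x (g m : R) :
  let y := x - g *: grad f x in
  0 < g * L <= gammaL1 (mu / L) ->
  m <= enorm (grad f x) ^+ 2 -> m <= enorm (grad f y) ^+ 2 ->
  g * L * pfun (g * L) (g * mu) * m <= 2 * L * (f x - f y).
Proof.
move=> /=; rewrite !sqr_enorm.
have [y yE] : {y | y = x - g *: grad f x} by eexists.
rewrite -yE => gL mx my.
have /andP[_ gL1] := gammaL1_bounds _ kappa_le0.
have /andP[gL0 gL_le] := gL.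
have muL : mu < L by exact: le_lt_trans L_gt0.
have Lmu0 : 0 < L - mu by rewrite subr_gt0.
have g0 : 0 < g by rewrite -(pmulr_lgt0 _ L_gt0).
have xy : x - y = g *: grad f x by rewrite yE opprD addrA subrr add0r opprK.
have yx : y - x = - g *: grad f x by rewrite -opprB xy scaleNr.
have := interpolation _ _ _ f_class x y muL.
have := interpolation _ _ _ f_class y x muL.
rewrite xy yx; move: mx my; move: (grad f x) (grad f y) => p q.
have := dot_AGM p q; rewrite !dotE (dotC q p).
move: (dot p p) (dot q q) (dot p q) => a b c cab ma mb.
(* Both directions of [interpolation] have the same left side [S], which is
   unchanged when the two points are exchanged. *)
pose S := mu / 2 * g ^+ 2 * a
  + ((1 - g * mu) ^+ 2 * a - 2 * (1 - g * mu) * c + b) / (2 * (L - mu)).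
set lhs1 := (X in X <= _ -> _); set lhs2 := (X in _ -> X <= _ -> _).
have -> : lhs1 = S by rewrite /lhs1 /S; field; exact: lt0r_neq0.
have -> : lhs2 = S by rewrite /lhs2 /S; field; exact: lt0r_neq0.
move=> S1 S2; clear lhs1 lhs2.
apply: (weighted_decrease _ _ a b c m (2 * L * S)) => //.
- by rewrite pmulr_rle0.
- by rewrite gL0 (le_lt_trans gL_le).
- have := gammaL1_quadratic _ _ kappa_le0 gL.
  by have -> : mu / L * (g * L) = g * mu by field; exact: lt0r_neq0.
- by rewrite /S; field; exact: lt0r_neq0.
- by have := ler_wpM2l (ltW L_gt0) S2; lra.
- by have := ler_wpM2l (ltW L_gt0) S1; lra.
Qed.

(** The upper parabola at [x] is minimised by a step of length [1 / L], which
    decreases [f] by at least [|grad f x|^2 / (2 L)]. *)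
Lemma sqr_grad_le x (fmin : R) : (forall y, fmin <= f y) ->
  enorm (grad f x) ^+ 2 <= 2 * L * (f x - fmin).
Proof.
move=> fminP; rewrite sqr_enorm.
have /andP[_] := curvature_bounds _ _ _ f_class x (- L^-1 *: grad f x).
have := fminP (x + - L^-1 *: grad f x).
rewrite !dotE; move: (f (x + _)) (dot _ _) => fy a fy_ge.
have -> : L / 2 * (- L^-1 * (- L^-1 * a)) = L^-1 * a / 2.
  by field; exact: lt0r_neq0.
move=> h; have {h} : L^-1 * a <= 2 * (f x - fmin) by lra.
by rewrite mulrC ler_pdivrMr// => h; lra.
Qed.

Lemma telescoped_decrease (N : nat) (gamma : nat -> R)
    (x : nat -> 'rV[R]_d) (m : R) :
  (forall i, (i < N)%N -> 0 < gamma i * L <= gammaL1 (mu / L)) ->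
  (forall i, (i < N)%N -> x i.+1 = x i - gamma i *: grad f (x i)) ->
  (forall i, (i <= N)%N -> m <= enorm (grad f (x i)) ^+ 2) ->
  (\sum_(i < N) gamma i * L * pfun (gamma i * L) (gamma i * mu)) * m
    <= 2 * L * (f (x 0%N) - f (x N)).
Proof.
elim: N => [|N IH] hg hx hm; first by rewrite big_ord0 mul0r subrr mulr0.
have := gradient_step_decrease (x N) _ m (hg N (ltnSn N)).
rewrite /= -hx// => /(_ (hm _ (leqnSn N)) (hm _ (leqnn _))) step.
have {}IH : (\sum_(i < N) gamma i * L * pfun (gamma i * L) (gamma i * mu)) * m
    <= 2 * L * (f (x 0%N) - f (x N)).
  by apply: IH => i iN; [apply: hg|apply: hx|apply: hm]; exact: leqW.
by rewrite big_ord_recr /= mulrDl; lra.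
Qed.

End Descent.

Theorem theorem2p5 (R : realType) (d : nat) (L mu : R) (f : 'rV[R]_d -> R)
    (N : nat) (gamma : nat -> R) (x : nat -> 'rV[R]_d)
    (L_gt0 : 0 < L) (mu_le0 : mu <= 0)
    (f_class : curvature_class mu L f)
    (f_lb : has_lbound (range f))
    (N_ge1 : (1 <= N)%N)
    (gamma_step : forall i : nat, (i < N)%N ->
       0 < gamma i * L <= gammaL1 (mu / L))
    (x_gd : forall i : nat, (i < N)%N ->
       x i.+1 = x i - gamma i *: grad f (x i)) :
  [/\ 3 / 2 <= gammaL1 (mu / L) < 2,
      forall l u : R, u <= 0 ->
        (0 < l <= 1 -> pfun l u = 2 - (- l * u) / (l - u)) /\
        (1 <= l < 2 -> pfun l u = (2 - l) * (2 - u) / (2 - l - u))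
    & 1 / (2 * L) *
        \big[Num.min/enorm (grad f (x 0%N)) ^+ 2]_(i < N.+1)
          enorm (grad f (x i)) ^+ 2
      <= (f (x 0%N) - inf (range f)) /
         (1 + \sum_(i < N) gamma i * L * pfun (gamma i * L) (gamma i * mu))].
Proof.
have kappa0 := kappa_le0 _ _ L_gt0 mu_le0.
split; first exact: gammaL1_bounds.
  move=> l u u0; split; last exact: pfun_long.
  by move=> /andP[_]; exact: pfun_short.
set m := \big[_/_]_(_ < _) _.
have mP i : (i <= N)%N -> m <= enorm (grad f (x i)) ^+ 2.
  move=> iN; exact: (bigmin_le _ (Ordinal (iN : (i < N.+1)%N))
    (fun j : 'I_N.+1 => enorm (grad f (x j)) ^+ 2)).
have sum_ge0 :
    0 <= \sum_(i < N) gamma i * L * pfun (gamma i * L) (gamma i * mu).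
  apply: sumr_ge0 => i _; have /andP[g0 g1] := gamma_step i (ltn_ord i).
  have /andP[_ g2] := gammaL1_bounds _ kappa0.
  apply: mulr_ge0 (ltW g0) (pfun_ge0 _ _ _ _).
    by rewrite pmulr_rle0// -(pmulr_lgt0 _ L_gt0).
  by rewrite g0 (le_lt_trans g1).
have fmin y : inf (range f) <= f y by apply: ge_inf => //; exists y.
have := sqr_grad_le _ _ _ L_gt0 f_class (x N) _ fmin.
have := telescoped_decrease _ _ _ L_gt0 mu_le0 f_class
  _ _ _ m gamma_step x_gd mP.
have := mP N (leqnn N).
move: (\sum_(_ < _) _) sum_ge0 => s s0 mN h1 h2.
rewrite ler_pdivlMr ?ltr_wpDr// mul1r -mulrA ler_pdivrMl ?mulr_gt0//.
by rewrite mulrDr mulr1; lra.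
Qed.
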